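(* Let $\mathsf{C}$ be a quasi-Markov category such that: (1) $\mathsf{C}$ is positive and $\sigma$-continuous; (2) countable Kolmogorov products exist in $\mathsf{C}$; (3) all balanced idempotents in $\mathsf{C}$ split; (4) every object $X$ of $\mathsf{C}$ has an empirical sampling morphism $\mathsf{es}: X^{\mathbb{N}} \to X$. Then for arbitrary morphisms $p:I\to X$ and $m:PX\to X$ in $\mathsf{C}$, the morphisms $m\,\mathsf{es}^\sharp$ and $m\,p^\sharp\,\mathrm{del}_{X^{\mathbb{N}}}$ of type $X^{\mathbb{N}}\to X$ are $p^{(\mathbb{N})}$-almost surely equal, that is, $$(m\,\mathsf{es}^\sharp\otimes\mathrm{id}_{X^{\mathbb{N}}})\,\mathrm{copy}_{X^{\mathbb{N}}}\,p^{(\mathbb{N})}=(m\,p^\sharp\,\mathrm{del}_{X^{\mathbb{N}}}\otimes\mathrm{id}_{X^{\mathbb{N}}})\,\mathrm{copy}_{X^{\mathbb{N}}}\,p^{(\mathbb{N})}.$$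
   Context: Notation: $\mathbb{N}=\{1,2,3,\ldots\}$; composition is written by juxtaposition; coherence isomorphisms are suppressed. A CD category is a symmetric monoidal category $(\mathsf{C},\otimes,I)$ in which every object $X$ carries a distinguished commutative comonoid structure $\mathrm{copy}_X:X\to X\otimes X$, $\mathrm{del}_X:X\to I$, compatible with the tensor product (these are not required to be natural). A morphism $f:A\to X$ is total if $\mathrm{del}_X f=\mathrm{del}_A$; quasi-total if $f=(f\otimes \mathrm{del}_X f)\,\mathrm{copy}_A$; copyable if $\mathrm{copy}_X f=(f\otimes f)\,\mathrm{copy}_A$; deterministic if total and copyable. A quasi-Markov category is a CD category in which every morphism is quasi-total. $\mathsf{C}_{\rm cop}$ is the wide subcategory of copyable morphisms. $\mathsf{C}$ is positive if for all $f:X\to Y$, $g:Y\to Z$ with $gf$ copyable one has $(\mathrm{id}_Y\otimes g)\,\mathrm{copy}_Y f=(f\otimes gf)\,\mathrm{copy}_X$. For $p:A\to X$ and $f,g:X\to Y$, $f$ and $g$ are $p$-almost surely equal if $(f\otimes \mathrm{id}_X)\,\mathrm{copy}_X\,p=(g\otimes \mathrm{id}_X)\,\mathrm{copy}_X\,p$. The domain of $f:A\to X$ is $\mathrm{dom}(f)=(\mathrm{id}_A\otimes \mathrm{del}_X f)\,\mathrm{copy}_A:A\to A$. For $f,g:A\to X$, write $f\sqsupseteq g$ ($f$ extends $g$) if $f\,\mathrm{dom}(g)=g$; this is a partial order on hom-sets. A positive quasi-Markov category is $\sigma$-continuous if, with respect to $\sqsupseteq$, every descending sequence $f_1\sqsupseteq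 f_2\sqsupseteq\cdots$ of morphisms $X\to Y$ has a meet (greatest lower bound) $\bigwedge_n f_n$, and these meets are preserved by pre- and post-composition and by tensoring with arbitrary morphisms. A Kolmogorov product $\bigotimes_{i\in\mathbb{N}}X_i$ of a sequence of objects is a limit in $\mathsf{C}$ of the diagram $\cdots\to X_1\otimes\cdots\otimes X_n\to\cdots\to X_1\otimes X_2\to X_1$ (arrows delete the last factor) whose cone components $\pi_n:\bigotimes_{i\in\mathbb{N}} X_i\to X_1\otimes\cdots\otimes X_n$ are deterministic and which is preserved by $-\otimes Y$ for every object $Y$. $X^{\mathbb{N}}$ denotes the Kolmogorov power (all $X_i=X$). For $f:A\to X$, $f^{(n)}:A\to X^{\otimes n}$ is the $n$-fold copy of $A$ followed by $f^{\otimes n}$, and $f^{(\mathbb{N})}:A\to X^{\mathbb{N}}$ is the unique morphism with $\pi_n f^{(\mathbb{N})}=f^{(n)}$ for all $n$. For a finite permutation $\sigma$ of $\mathbb{N}$ (a bijection fixing all but finitely many elements), $X^\sigma:X^{\mathbb{N}}\to X^{\mathbb{N}}$ is the induced deterministic morphism permuting the factors (its $i$-th output is its $\sigma(i)$-th input). A morphism $f:A\to X^{\mathbb{N}}\otimes Y$ is exchangeable in the first factor if $(X^\sigma\otimes \mathrm{id}_Y)f=f$ for every finite permutation $\sigma$. An empirical sampling morphism for $X$ is a morphism $\mathsf{es}:X^{\mathbb{N}}\to X$ such that (i) $\mathsf{es}\,X^\sigma=\mathsf{es}$ for every finite permutation $\sigma$ of $\mathbb{N}$, and (ii) for all objects $A,Y$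 and every $f:A\to X^{\mathbb{N}}\otimes Y$ exchangeable in the first factor, $(\mathsf{es}^{(\mathbb{N})}\otimes\mathrm{id}_Y)f=f$. An idempotent $e:X\to X$ is balanced if $(\mathrm{id}_X\otimes e)\,\mathrm{copy}_X e=(e\otimes \mathrm{id}_X)\,\mathrm{copy}_X e$. It splits if there are $\pi:X\to E$, $\iota:E\to X$ with $e=\iota\pi$ and $\pi\iota=\mathrm{id}_E$. A distribution object for $X$ is an object $PX$ with bijections $\mathsf{C}(A,X)\cong\mathsf{C}_{\rm cop}(A,PX)$, $f\mapsto f^\sharp$, natural in $A\in\mathsf{C}_{\rm cop}$; the sampling morphism $\mathsf{samp}:PX\to X$ is the counterpart of $\mathrm{id}_{PX}$, so that $f=\mathsf{samp}\,f^\sharp$. Under hypotheses (1)--(4), every object has a distribution object (indeed $\mathsf{C}$ is observationally representable: for every $X$ the family $(\mathsf{samp}^{(n)}:PX\to X^{\otimes n})_{n\in\mathbb{N}}$ is jointly monic), and $PX$, $(-)^\sharp$ refer to these; $\mathsf{es}^\sharp:X^{\mathbb{N}}\to PX$ and $p^\sharp:I\to PX$ are the counterparts of $\mathsf{es}$ and $p$. *)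

(* Defs.v *)
From mathcomp Require Import ssreflect ssrfun ssrbool eqtype ssrnat.

Set Implicit Arguments.
Unset Strict Implicit.
Unset Printing Implicit Defensive.

Declare Scope cat_scope.
Open Scope cat_scope.

Record category := Category {
  ob :> Type;
  hom : ob -> ob -> Type;
  idm : forall A, hom A A;
  comp : forall A B D, hom B D -> hom A B -> hom A D;
  comp_idl : forall A B (f : hom A B), comp (idm B) f = f;
  comp_idr : forall A B (f : hom A B), comp f (idm A) = f;
  comp_assoc : forall A B D E (h : hom D E) (g : hom B D) (f : hom A B),
    comp h (comp g f) = comp (comp h g) f
}.
Arguments hom {c} A B.
Arguments idm {c} A.
Arguments comp {c A B D} g f.

Notation "g ∘ f" := (comp g f) (at level 40, left associativity) : cat_scope.

(* Monoidal categories are not assumed strict: the suppressed coherence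
   isomorphisms are written out. *)
Record symmetric_monoidal_category := SymmetricMonoidalCategory {
  smc_category :> category;
  munit : smc_category;
  tens : smc_category -> smc_category -> smc_category;
  tensm : forall A A' B B' : smc_category,
    hom A A' -> hom B B' -> hom (tens A B) (tens A' B');
  tensm_id : forall A B, tensm (idm A) (idm B) = idm (tens A B);
  tensm_comp : forall (A A' A'' B B' B'' : smc_category)
      (f' : hom A' A'') (f : hom A A') (g' : hom B' B'') (g : hom B B'),
    tensm (f' ∘ f) (g' ∘ g) = tensm f' g' ∘ tensm f g;

  assoc : forall A B D, hom (tens (tens A B) D) (tens A (tens B D));
  assoc_inv : forall A B D, hom (tens A (tens B D)) (tens (tens A B) D);
  assocK : forall A B D, assoc_inv A B D ∘ assoc A B D = idm _;
  assoc_invK : forall A B D, assoc A B D ∘ assoc_inv A B D = idm _;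
  assoc_nat : forall (A A' B B' D D' : smc_category)
      (f : hom A A') (g : hom B B') (h : hom D D'),
    assoc A' B' D' ∘ tensm (tensm f g) h = tensm f (tensm g h) ∘ assoc A B D;

  lunit : forall A, hom (tens munit A) A;
  lunit_inv : forall A, hom A (tens munit A);
  lunitK : forall A, lunit_inv A ∘ lunit A = idm _;
  lunit_invK : forall A, lunit A ∘ lunit_inv A = idm _;
  lunit_nat : forall (A A' : smc_category) (f : hom A A'),
    lunit A' ∘ tensm (idm munit) f = f ∘ lunit A;

  runit : forall A, hom (tens A munit) A;
  runit_inv : forall A, hom A (tens A munit);
  runitK : forall A, runit_inv A ∘ runit A = idm _;
  runit_invK : forall A, runit A ∘ runit_inv A = idm _;
  runit_nat : forall (A A' : smc_category) (f : hom A A'),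
    runit A' ∘ tensm f (idm munit) = f ∘ runit A;

  braid : forall A B, hom (tens A B) (tens B A);
  braidK : forall A B, braid B A ∘ braid A B = idm _;
  braid_nat : forall (A A' B B' : smc_category) (f : hom A A') (g : hom B B'),
    braid A' B' ∘ tensm f g = tensm g f ∘ braid A B;

  triangle : forall A B,
    tensm (idm A) (lunit B) ∘ assoc A munit B = tensm (runit A) (idm B);
  pentagon : forall A B D E,
    assoc A B (tens D E) ∘ assoc (tens A B) D E
    = tensm (idm A) (assoc B D E) ∘ assoc A (tens B D) E
      ∘ tensm (assoc A B D) (idm E);
  hexagon : forall A B D,
    assoc B D A ∘ braid A (tens B D) ∘ assoc A B D
    = tensm (idm B) (braid A D) ∘ assoc B A D ∘ tensm (braid A B) (idm D)
}.
Arguments munit {s}.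
Arguments tens {s} A B.
Arguments tensm {s A A' B B'} f g.
Arguments assoc {s} A B D.
Arguments assoc_inv {s} A B D.
Arguments lunit {s} A.
Arguments lunit_inv {s} A.
Arguments runit {s} A.
Arguments runit_inv {s} A.
Arguments braid {s} A B.

Notation "A ⊗ B" := (tens A B) (at level 38, left associativity) : cat_scope.
Notation "f ⊠ g" := (tensm f g) (at level 38, left associativity) : cat_scope.

Definition middle_swap (C : symmetric_monoidal_category) (A B D E : C) :
    hom ((A ⊗ B) ⊗ (D ⊗ E)) ((A ⊗ D) ⊗ (B ⊗ E)) :=
  assoc_inv A D (B ⊗ E)
  ∘ (idm A ⊠ (assoc D B E ∘ (braid B D ⊠ idm E) ∘ assoc_inv B D E))
  ∘ assoc A B (D ⊗ E).

Record cd_category := CDCategory {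
  cd_smc :> symmetric_monoidal_category;
  copy : forall A : cd_smc, hom A (A ⊗ A);
  del : forall A : cd_smc, hom A munit;
  copy_assoc : forall A,
    assoc A A A ∘ (copy A ⊠ idm A) ∘ copy A = (idm A ⊠ copy A) ∘ copy A;
  copy_unitl : forall A, lunit A ∘ (del A ⊠ idm A) ∘ copy A = idm A;
  copy_unitr : forall A, runit A ∘ (idm A ⊠ del A) ∘ copy A = idm A;
  copy_comm : forall A, braid A A ∘ copy A = copy A;
  copy_tens : forall A B,
    copy (A ⊗ B) = middle_swap A A B B ∘ (copy A ⊠ copy B);
  copy_munit : copy munit = lunit_inv munit;
  del_tens : forall A B, del (A ⊗ B) = lunit munit ∘ (del A ⊠ del B);
  del_munit : del munit = idm munit
}.
Arguments copy {c} A.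
Arguments del {c} A.

Section MorphismClasses.
Context {C : cd_category}.

Definition is_total (A X : C) (f : hom A X) : Prop := del X ∘ f = del A.

Definition quasi_total (A X : C) (f : hom A X) : Prop :=
  f = runit X ∘ (f ⊠ (del X ∘ f)) ∘ copy A.

Definition copyable (A X : C) (f : hom A X) : Prop :=
  copy X ∘ f = (f ⊠ f) ∘ copy A.

Definition deterministic (A X : C) (f : hom A X) : Prop :=
  is_total f /\ copyable f.

Definition as_equal (A X Y : C) (p : hom A X) (f g : hom X Y) : Prop :=
  (f ⊠ idm X) ∘ copy X ∘ p = (g ⊠ idm X) ∘ copy X ∘ p.

Definition dom (A X : C) (f : hom A X) : hom A A :=
  runit A ∘ (idm A ⊠ (del X ∘ f)) ∘ copy A.

Definition extends (A X : C) (f g : hom A X) : Prop := f ∘ dom g = g.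

Definition descending (A X : C) (f : nat -> hom A X) : Prop :=
  forall n, extends (f n) (f n.+1).

Definition is_meet (A X : C) (f : nat -> hom A X) (m : hom A X) : Prop :=
  (forall n, extends (f n) m)
  /\ (forall g : hom A X, (forall n, extends (f n) g) -> extends m g).

Definition idempotent (X : C) (e : hom X X) : Prop := e ∘ e = e.

Definition balanced (X : C) (e : hom X X) : Prop :=
  (idm X ⊠ e) ∘ copy X ∘ e = (e ⊠ idm X) ∘ copy X ∘ e.

Definition splits (X : C) (e : hom X X) : Prop :=
  exists (E : C) (q : hom X E) (i : hom E X), e = i ∘ q /\ q ∘ i = idm E.

End MorphismClasses.

Record quasi_markov_category := QuasiMarkovCategory {
  qm_cd :> cd_category;
  all_quasi_total : forall (A X : qm_cd) (f : hom A X), quasi_total f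
}.

Definition positive (C : cd_category) : Prop :=
  forall (X Y Z : C) (f : hom X Y) (g : hom Y Z), copyable (g ∘ f) ->
    (idm Y ⊠ g) ∘ copy Y ∘ f = (f ⊠ (g ∘ f)) ∘ copy X.

Definition sigma_continuous (C : cd_category) : Prop :=
  forall (X Y : C) (f : nat -> hom X Y), descending f ->
  exists2 m : hom X Y, is_meet f m &
    [/\ forall (W : C) (h : hom W X), is_meet (fun n => f n ∘ h) (m ∘ h),
        forall (Z : C) (h : hom Y Z), is_meet (fun n => h ∘ f n) (h ∘ m),
        forall (V W : C) (h : hom V W), is_meet (fun n => f n ⊠ h) (m ⊠ h) &
        forall (V W : C) (h : hom V W), is_meet (fun n => h ⊠ f n) (h ⊠ m)].

(* The limit cones of a sequential diagram, with chosen mediating morphisms. *)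
Record limit_cone (C : category) (D : nat -> C)
    (d : forall n, hom (D n.+1) (D n))
    (L : C) (pr : forall n, hom L (D n)) := LimitCone {
  cone_comm : forall n, d n ∘ pr n.+1 = pr n;
  lift : forall (A : C) (f : forall n, hom A (D n)),
    (forall n, d n ∘ f n.+1 = f n) -> hom A L;
  lift_proj : forall (A : C) (f : forall n, hom A (D n))
    (Hf : forall n, d n ∘ f n.+1 = f n) n, pr n ∘ lift Hf = f n;
  lift_uniq : forall (A : C) (f : forall n, hom A (D n))
    (Hf : forall n, d n ∘ f n.+1 = f n) (g : hom A L),
    (forall n, pr n ∘ g = f n) -> g = lift Hf
}.

Section FiniteTensors.
Context {C : cd_category}.

(* Sequences are indexed from 0, so [ftens X n] has the n + 1 factors
   X 0, ..., X n: the empty tensor is not part of the diagrams below. *)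
Fixpoint ftens (X : nat -> C) (n : nat) : C :=
  if n is k.+1 then ftens X k ⊗ X k.+1 else X 0.

Definition trunc (X : nat -> C) (n : nat) : hom (ftens X n.+1) (ftens X n) :=
  runit (ftens X n) ∘ (idm (ftens X n) ⊠ del (X n.+1)).

Definition flast (X : nat -> C) (n : nat) : hom (ftens X n) (X n) :=
  match n return hom (ftens X n) (X n) with
  | 0 => idm (X 0)
  | k.+1 => lunit (X k.+1) ∘ (del (ftens X k) ⊠ idm (X k.+1))
  end.

Fixpoint ftensm (X Y : nat -> C) (f : forall i, hom (X i) (Y i)) (n : nat) :
    hom (ftens X n) (ftens Y n) :=
  match n return hom (ftens X n) (ftens Y n) with
  | 0 => f 0
  | k.+1 => ftensm f k ⊠ f k.+1
  end.

Fixpoint ncopy (A : C) (n : nat) : hom A (ftens (fun=> A) n) :=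
  match n return hom A (ftens (fun=> A) n) with
  | 0 => idm A
  | k.+1 => (ncopy A k ⊠ idm A) ∘ copy A
  end.

Definition ftuple (A : C) (X : nat -> C) (f : forall i, hom A (X i)) (n : nat) :
    hom A (ftens X n) :=
  ftensm f n ∘ ncopy A n.

End FiniteTensors.

Record kolmogorov_product (C : cd_category) (X : nat -> C) := KolmogorovProduct {
  kp_ob :> C;
  kp_proj : forall n, hom kp_ob (ftens X n);
  kp_proj_det : forall n, deterministic (kp_proj n);
  kp_limit : limit_cone (trunc X) kp_proj;
  kp_limit_tens : forall Y : C,
    limit_cone (fun n => trunc X n ⊠ idm Y) (fun n => kp_proj n ⊠ idm Y)
}.
Arguments kp_proj {C X} k n.

Definition kolmogorov_power (C : cd_category) (X : C) :=
  kolmogorov_product (fun=> X).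

Definition kp_component (C : cd_category) (X : nat -> C)
    (K : kolmogorov_product X) (i : nat) : hom K (X i) :=
  flast X i ∘ kp_proj K i.

(* The truncations commute with the two families of morphisms into finite
   tensors used below: tuples of total morphisms (for X^σ) and iterates of one
   quasi-total morphism (for f^(N)). *)

Lemma tensm_munit_inj (C : symmetric_monoidal_category) (A B : C)
    (f g : hom A B) :
  f ⊠ idm munit = g ⊠ idm munit -> f = g.
Proof.
move=> e; rewrite -(comp_idr f) -(comp_idr g) -(runit_invK A).
by rewrite !comp_assoc -!runit_nat e.
Qed.

Lemma runit_tens (C : symmetric_monoidal_category) (A B : C) :
  runit (A ⊗ B) = (idm A ⊠ runit B) ∘ assoc A B munit.
Proof.
apply: tensm_munit_inj.
have tensm_compl (X Y Z W : C) (g : hom Y Z) (f : hom X Y) :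
    (g ∘ f) ⊠ idm W = (g ⊠ idm W) ∘ (f ⊠ idm W).
  by rewrite -tensm_comp comp_idl.
have assoc_inj (X : C) (u v : hom X ((A ⊗ B) ⊗ munit)) :
    assoc A B munit ∘ u = assoc A B munit ∘ v -> u = v.
  by move=> e; rewrite -[u]comp_idl -[v]comp_idl -assocK -!comp_assoc e.
apply: assoc_inj.
rewrite tensm_compl comp_assoc assoc_nat -!triangle comp_assoc.
rewrite -tensm_id assoc_nat -[LHS]comp_assoc pentagon !comp_assoc.
by rewrite -tensm_comp comp_idl.
Qed.

Lemma ftupleS (C : cd_category) (A : C) (X : nat -> C)
    (f : forall i, hom A (X i)) n :
  ftuple f n.+1 = (ftuple f n ⊠ f n.+1) ∘ copy A.
Proof. by rewrite /ftuple /= comp_assoc -tensm_comp comp_idr. Qed.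

Lemma trunc_ftupleS (C : cd_category) (A : C) (X : nat -> C)
    (f : forall i, hom A (X i)) n :
  trunc X n ∘ ftuple f n.+1
  = runit _ ∘ (ftuple f n ⊠ (del _ ∘ f n.+1)) ∘ copy A.
Proof.
rewrite ftupleS /trunc comp_assoc -[in LHS](comp_assoc (runit _)) -tensm_comp.
by rewrite comp_idl.
Qed.

Lemma trunc_ftuple_total (C : cd_category) (A : C) (X : nat -> C)
    (f : forall i, hom A (X i)) :
  (forall i, is_total (f i)) ->
  forall n, trunc X n ∘ ftuple f n.+1 = ftuple f n.
Proof.
move=> ftot n; rewrite trunc_ftupleS ftot.
rewrite -[ftuple f n in LHS]comp_idr -[del A]comp_idl tensm_comp.
by rewrite comp_assoc runit_nat -!comp_assoc (comp_assoc (runit A))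
           copy_unitr comp_idr.
Qed.

Lemma trunc_ftuple_const (C : quasi_markov_category) (A X : C) (f : hom A X) n :
  trunc (fun=> X) n ∘ ftuple (fun=> f) n.+1 = ftuple (fun=> f) n.
Proof.
rewrite trunc_ftupleS; case: n => [|n].
  by rewrite /ftuple /= comp_idr -all_quasi_total.
rewrite ftupleS -[del X ∘ f]comp_idr tensm_comp runit_tens.
rewrite -!comp_assoc (comp_assoc (assoc _ _ _)) assoc_nat -!comp_assoc.
rewrite (comp_assoc (assoc A A A)) copy_assoc !comp_assoc -!tensm_comp.
by rewrite comp_idl comp_idr -all_quasi_total.
Qed.

Lemma kp_component_total (C : cd_category) (X : nat -> C)
    (K : kolmogorov_product X) i :
  is_total (kp_component K i).
Proof.
rewrite /is_total /kp_component comp_assoc.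
have -> : del (X i) ∘ flast X i = del (ftens X i).
  case: i => [|i] /=; first by rewrite comp_idr.
  by rewrite comp_assoc -lunit_nat -comp_assoc -tensm_comp comp_idl comp_idr
             del_tens.
by case: (kp_proj_det K i).
Qed.

Definition kp_perm (C : cd_category) (X : C) (K : kolmogorov_power X)
    (s : nat -> nat) : hom K K :=
  lift (kp_limit K)
    (trunc_ftuple_total (fun i => kp_component_total K (s i))).

(* [kp_iter K f] is the morphism f^(N). *)
Definition kp_iter (C : quasi_markov_category) (A X : C)
    (K : kolmogorov_power X) (f : hom A X) : hom A K :=
  lift (kp_limit K) (trunc_ftuple_const f).

Definition finite_permutation (s : nat -> nat) : Prop :=
  bijective s /\ exists N, forall n, N <= n -> s n = n.

Definition exchangeable (C : cd_category) (X : C) (K : kolmogorov_power X)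
    (A Y : C) (f : hom A (K ⊗ Y)) : Prop :=
  forall s, finite_permutation s -> (kp_perm K s ⊠ idm Y) ∘ f = f.

Definition empirical_sampling (C : quasi_markov_category) (X : C)
    (K : kolmogorov_power X) (es : hom K X) : Prop :=
  (forall s, finite_permutation s -> es ∘ kp_perm K s = es)
  /\ (forall (A Y : C) (f : hom A (K ⊗ Y)), exchangeable f ->
        (kp_iter K es ⊠ idm Y) ∘ f = f).

(* [sharp] is a bijection from hom A X onto the copyable morphisms A -> PX,
   natural with respect to copyable morphisms in A. *)
Record distribution_object (C : cd_category) (X : C) := DistributionObject {
  do_ob :> C;
  sharp : forall A : C, hom A X -> hom A do_ob;
  sharp_copyable : forall (A : C) (f : hom A X), copyable (sharp f);
  sharp_inj : forall A : C, injective (@sharp A);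
  sharp_surj : forall (A : C) (g : hom A do_ob), copyable g ->
    exists f : hom A X, sharp f = g;
  sharp_nat : forall (A B : C) (h : hom A B) (f : hom B X), copyable h ->
    sharp (f ∘ h) = sharp f ∘ h
}.
Arguments sharp {C X} d {A} f.

(* Main.v *)
From mathcomp Require Import ssreflect ssrfun ssrbool eqtype ssrnat.
From mathcomp Require Import zify.
Require Import Defs.

(** Write K for the Kolmogorov power of X, e = es^(N) : K -> K and q = p^(N).
    The statement is a strong law of large numbers, and it reduces to the
    equation es^# q = p^#: the right-hand side is copyable, so positivity turns
    this equation about a composite into one about the joint morphism with the
    sample sequence q ([positive_pair]), after which m is just post-composed.

    Since (-)^# is natural along copyable morphisms only, and q need
    not be copyable, es^# q = p^# is not immediate from es q = p.  The passage goes
    through the space of empirical measures, obtained by splitting e.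

    Any iterate f^(N) is invariant under finite permutations
    ([kp_perm_iter]), so empirical adequacy gives e f^(N) = f^(N)
    ([es_absorb_iter]).  Three consequences carry the proof.
    - e is idempotent, and it is balanced: resampling one of two copies of e is
      exchangeable in the other copy, hence unchanged when that copy is
      resampled too ([es_balanced]).  Let e = i r be a splitting.
    - Two independent resamplings from the empirical measure of one iid
      sequence are two iid sequences independent of each other, because n + m
      samples from that measure have the joint law f^(n+m) ([es_resample]).  Applying r
      to both gives (r ⊗ r) copy f^(N) = (r f^(N) ⊗ r f^(N)) copy.
    - By positivity for r i = id, copy on the splitting object is
      (r ⊗ r) copy i.  Combined with the previous point, both r and r f^(N) are
      copyable ([es_split_copyable]): the empirical measure of an iid sequence
      is not random once the law is given.

    Now es = es e = (es i) r, so es^# = (es i)^# r, and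
    es^# q = (es i)^# (r q) = (es i r q)^# = (es q)^# = p^#
    ([sharp_es_iter]). *)

Set Implicit Arguments.
Unset Strict Implicit.
Unset Printing Implicit Defensive.

(* Innermost tests are decided first, so that no test is left inside the terms
   handed over to the arithmetic solver. *)
Local Ltac lia_eq :=
  repeat match goal with |- context [if ?a == ?b then _ else _] =>
    lazymatch a with
    | context [if _ then _ else _] => fail
    | _ => case: (a =P b) => ?
    end
  end; lia.

(** * Pairings in a CD category *)

Section Pairing.
Context {C : cd_category}.

(** Working with pairings hides the coherence isomorphisms: the copy axioms
    become the rules by which [assoc], [braid] and [middle_swap] rearrange
    nested pairs. *)
Definition pair (A X Y : C) (f : hom A X) (g : hom A Y) : hom A (X ⊗ Y) :=
  (f ⊠ g) ∘ copy A.

Lemma tensm_pair (A X Y X' Y' : C) (a : hom X X') (b : hom Y Y')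
    (f : hom A X) (g : hom A Y) :
  (a ⊠ b) ∘ pair f g = pair (a ∘ f) (b ∘ g).
Proof. by rewrite /pair comp_assoc -tensm_comp. Qed.

Lemma pair_comp (A B X Y : C) (f : hom B X) (g : hom B Y) (u : hom A B) :
  copyable u -> pair f g ∘ u = pair (f ∘ u) (g ∘ u).
Proof. by rewrite /pair -comp_assoc => ->; rewrite comp_assoc -tensm_comp. Qed.

Lemma pair_id (A : C) : pair (idm A) (idm A) = copy A.
Proof. by rewrite /pair tensm_id comp_idl. Qed.

Lemma braid_pair (A X Y : C) (f : hom A X) (g : hom A Y) :
  braid X Y ∘ pair f g = pair g f.
Proof. by rewrite /pair comp_assoc braid_nat -comp_assoc copy_comm. Qed.

Lemma assoc_pair (A X Y Z : C) (f : hom A X) (g : hom A Y) (h : hom A Z) :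
  assoc X Y Z ∘ pair (pair f g) h = pair f (pair g h).
Proof.
have -> : pair (pair f g) h = ((f ⊠ g) ⊠ h) ∘ pair (copy A) (idm A).
  by rewrite tensm_pair comp_idr.
have -> : pair f (pair g h) = (f ⊠ (g ⊠ h)) ∘ pair (idm A) (copy A).
  by rewrite tensm_pair comp_idr.
rewrite comp_assoc assoc_nat -comp_assoc; congr (_ ∘ _).
by rewrite /pair comp_assoc copy_assoc.
Qed.

Lemma assoc_inv_pair (A X Y Z : C) (f : hom A X) (g : hom A Y) (h : hom A Z) :
  assoc_inv X Y Z ∘ pair f (pair g h) = pair (pair f g) h.
Proof. by rewrite -assoc_pair comp_assoc assocK comp_idl. Qed.

Lemma braid_copy (A K X Y : C) (f : hom K X) (g : hom K Y) (q : hom A K) :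
  (f ⊠ g) ∘ copy K ∘ q = braid Y X ∘ ((g ⊠ f) ∘ copy K ∘ q).
Proof.
by rewrite !comp_assoc braid_nat -(comp_assoc _ (braid K K)) copy_comm.
Qed.

Lemma middle_swap_pair (A X Y Z W : C) (f : hom A X) (g : hom A Y)
    (h : hom A Z) (k : hom A W) :
  middle_swap X Y Z W ∘ pair (pair f g) (pair h k)
  = pair (pair f h) (pair g k).
Proof.
rewrite /middle_swap -comp_assoc assoc_pair -comp_assoc tensm_pair comp_idl.
rewrite -!comp_assoc assoc_inv_pair tensm_pair comp_idl braid_pair assoc_pair.
by rewrite assoc_inv_pair.
Qed.

Lemma runit_pair_del (A X : C) (f : hom A X) : runit X ∘ pair f (del A) = f.
Proof.
have -> : pair f (del A) = (f ⊠ idm munit) ∘ pair (idm A) (del A).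
  by rewrite tensm_pair comp_idr comp_idl.
rewrite comp_assoc runit_nat -comp_assoc /pair (comp_assoc (runit _)).
by rewrite copy_unitr comp_idr.
Qed.

Lemma copyable_id (A : C) : copyable (idm A).
Proof. by rewrite /copyable tensm_id comp_idl comp_idr. Qed.

Lemma copyable_comp (A B D : C) (g : hom B D) (f : hom A B) :
  copyable g -> copyable f -> copyable (g ∘ f).
Proof.
rewrite /copyable => cg cf.
by rewrite comp_assoc cg -comp_assoc cf comp_assoc -tensm_comp.
Qed.

(** Positivity with the output of [g] in the first factor, the shape in which
    almost sure equality is stated. *)
Lemma positive_pair (A X Y : C) (f : hom A X) (g : hom X Y) :
  positive C -> copyable (g ∘ f) -> (g ⊠ idm X) ∘ copy X ∘ f = pair (g ∘ f) f.
Proof. by move=> Cpos /Cpos jfg; rewrite braid_copy jfg braid_pair. Qed.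

Lemma copyable_pair (A X Y : C) (f : hom A X) (g : hom A Y) :
  copyable f -> copyable g -> copyable (pair f g).
Proof.
move=> cf cg; rewrite /copyable copy_tens -comp_assoc tensm_pair cf cg.
exact: middle_swap_pair.
Qed.

Lemma lunit_pair_del (A X : C) (f : hom A X) : lunit X ∘ pair (del A) f = f.
Proof.
have -> : pair (del A) f = (idm munit ⊠ f) ∘ pair (del A) (idm A).
  by rewrite tensm_pair comp_idr comp_idl.
rewrite comp_assoc lunit_nat -comp_assoc /pair (comp_assoc (lunit _)).
by rewrite copy_unitl comp_idr.
Qed.

Lemma lunit_invE (A X : C) (f : hom A X) : lunit_inv X ∘ f = pair (del A) f.
Proof. by rewrite -{1}[f]lunit_pair_del comp_assoc lunitK comp_idl. Qed.

(** Counitality removes the copy of q that is discarded. *)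
Lemma pair_const (K Y : C) (q : hom munit K) (f : hom munit Y) :
  ((f ∘ del K) ⊠ idm K) ∘ copy K ∘ q = pair f q.
Proof.
have -> : (f ∘ del K) ⊠ idm K = (f ⊠ idm K) ∘ (del K ⊠ idm K).
  by rewrite -tensm_comp comp_idl.
have -> : (f ⊠ idm K) ∘ (del K ⊠ idm K) ∘ copy K = (f ⊠ idm K) ∘ lunit_inv K.
  by rewrite -comp_assoc -[lunit_inv K]comp_idr lunit_invE.
by rewrite -comp_assoc lunit_invE tensm_pair del_munit comp_idl comp_idr.
Qed.

Lemma runit_invE (A X : C) (f : hom A X) : runit_inv X ∘ f = pair f (del A).
Proof. by rewrite -{1}[f]runit_pair_del comp_assoc runitK comp_idl. Qed.

Lemma copyable_del (A : C) : copyable (del A).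
Proof. by rewrite /copyable copy_munit lunit_invE. Qed.

(** The inverse unitor is the pairing of [del] with the identity, so it is
    copyable, and inverses of copyable isomorphisms are copyable. *)
Lemma copyable_lunit (A : C) : copyable (lunit A).
Proof.
have cinv : copyable (lunit_inv A).
  rewrite -[lunit_inv A]comp_idr lunit_invE.
  exact: copyable_pair (@copyable_del A) (@copyable_id A).
rewrite /copyable -[RHS]comp_idr -(lunitK A) -[RHS]comp_assoc.
rewrite (comp_assoc (copy _)) cinv !comp_assoc -tensm_comp lunit_invK.
by rewrite tensm_id comp_idl.
Qed.

(** The copy on the unit is invertible and commutative, which forces the
    self-braiding of the unit to be trivial. *)
Lemma braid_munit : braid munit munit = idm (munit ⊗ munit :> C).
Proof.
have := copy_comm (munit : C); rewrite copy_munit => e.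
by rewrite -[LHS]comp_idr -lunitK comp_assoc e.
Qed.

Lemma assoc_inv_nat (A A' B B' D D' : C) (f : hom A A') (g : hom B B')
    (h : hom D D') :
  assoc_inv A' B' D' ∘ (f ⊠ (g ⊠ h)) = ((f ⊠ g) ⊠ h) ∘ assoc_inv A B D.
Proof.
rewrite -[RHS]comp_idl -assocK -!comp_assoc; congr (_ ∘ _).
by rewrite comp_assoc assoc_nat -comp_assoc assoc_invK comp_idr.
Qed.

Lemma middle_swap_nat (A A' B B' D D' E E' : C) (f : hom A A') (g : hom B B')
    (h : hom D D') (k : hom E E') :
  middle_swap A' B' D' E' ∘ ((f ⊠ g) ⊠ (h ⊠ k))
  = ((f ⊠ h) ⊠ (g ⊠ k)) ∘ middle_swap A B D E.
Proof.
have swap_nat : assoc D' B' E' ∘ (braid B' D' ⊠ idm E') ∘ assoc_inv B' D' E'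
      ∘ (g ⊠ (h ⊠ k))
    = (h ⊠ (g ⊠ k))
      ∘ (assoc D B E ∘ (braid B D ⊠ idm E) ∘ assoc_inv B D E).
  rewrite -comp_assoc assoc_inv_nat !comp_assoc -assoc_nat; congr (_ ∘ _).
  by rewrite -!comp_assoc -!tensm_comp braid_nat comp_idl comp_idr.
rewrite /middle_swap -[LHS]comp_assoc assoc_nat !comp_assoc -assoc_inv_nat.
congr (_ ∘ _); rewrite -!comp_assoc -!tensm_comp.
by rewrite !comp_assoc swap_nat comp_idl comp_idr !comp_assoc.
Qed.

Lemma copyable_tensm (A A' B B' : C) (f : hom A A') (g : hom B B') :
  copyable f -> copyable g -> copyable (f ⊠ g).
Proof.
move=> cf cg; rewrite /copyable !copy_tens -comp_assoc -tensm_comp cf cg.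
by rewrite tensm_comp [LHS]comp_assoc middle_swap_nat -[LHS]comp_assoc.
Qed.

(** By [copy_tens] and naturality of [middle_swap], the deletions act on the
    individual copies, where they cancel by counitality; what remains is a
    [middle_swap] of two units, trivial by [braid_munit]. *)
Lemma pair_proj (U V : C) :
  (runit U ∘ (idm U ⊠ del V)) ⊠ (lunit V ∘ (del U ⊠ idm V)) ∘ copy (U ⊗ V)
  = idm (U ⊗ V).
Proof.
rewrite tensm_comp copy_tens comp_assoc -(comp_assoc (runit U ⊠ _)).
rewrite -middle_swap_nat -!comp_assoc -tensm_comp.
have -> : (idm U ⊠ del U) ∘ copy U = runit_inv U.
  by rewrite -[RHS]comp_idr runit_invE.
have -> : (del V ⊠ idm V) ∘ copy V = lunit_inv V.
  by rewrite -[RHS]comp_idr lunit_invE.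
rewrite /middle_swap braid_munit tensm_id comp_idl assoc_invK tensm_id comp_idl.
rewrite (comp_assoc (assoc_inv _ _ _)) assocK comp_idl -tensm_comp.
by rewrite runit_invK lunit_invK tensm_id.
Qed.

End Pairing.

(** * Tuples and their reindexings *)

Section Tuples.
Context {C : cd_category}.

Lemma ftuple0 (A : C) (X : nat -> C) (c : forall i, hom A (X i)) :
  ftuple c 0 = c 0.
Proof. exact: comp_idr. Qed.

Lemma ftuple_pair (A : C) (X : nat -> C) (c : forall i, hom A (X i)) n :
  ftuple c n.+1 = pair (ftuple c n) (c n.+1).
Proof. exact: ftupleS. Qed.

Lemma eq_ftuple (A : C) (X : nat -> C) (c d : forall i, hom A (X i)) n :
  (forall i, i <= n -> c i = d i) -> ftuple c n = ftuple d n.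
Proof.
elim: n => [|n IHn] cd; first by rewrite !ftuple0; apply: cd.
by rewrite !ftuple_pair cd // IHn // => i le_in; apply/cd/leqW.
Qed.

Lemma ftuple_comp (A B : C) (X : nat -> C) (c : forall i, hom B (X i))
    (u : hom A B) n :
  copyable u -> ftuple c n ∘ u = ftuple (fun i => c i ∘ u) n.
Proof.
move=> cu; elim: n => [|n IHn]; first by rewrite !ftuple0.
by rewrite !ftuple_pair pair_comp // IHn.
Qed.

Lemma copyable_ftuple (A : C) (X : nat -> C) (c : forall i, hom A (X i)) n :
  (forall i, copyable (c i)) -> copyable (ftuple c n).
Proof.
move=> cc; elim: n => [|n IHn]; first by rewrite ftuple0; apply: cc.
by rewrite ftuple_pair; apply: copyable_pair.
Qed.

(** The rebracketing [P] is chosen before [A] and [f].  This lets one instance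
    be used both for the tuple of copies of es and for that of f. *)
Lemma ftuple_const_cat (X : C) (n m : nat) :
  exists P : hom (ftens (fun=> X) (m + n).+1)
                 (ftens (fun=> X) n ⊗ ftens (fun=> X) m),
  forall (A : C) (f : hom A X),
    pair (ftuple (fun=> f) n) (ftuple (fun=> f) m)
    = P ∘ ftuple (fun=> f) (m + n).+1.
Proof.
elim: m => [|m [P PE]].
  by exists (idm _) => A f; rewrite comp_idl ftuple_pair ftuple0.
exists (assoc _ _ _ ∘ (P ⊠ idm X)) => A f.
rewrite [ftuple _ (m.+1 + n).+1](ftuple_pair (fun=> f) (m + n).+1).
rewrite -comp_assoc tensm_pair comp_idl -PE.
by rewrite assoc_pair ftuple_pair.
Qed.

(** The permutation of tensor factors induced by [s], encoded by its effect on
    all tuples at once.  Uniformity in [A] and [c] is essential: the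
    permutation acts on the projections out of a Kolmogorov power and on
    constant tuples by the same [P].  On a constant tuple, reindexing changes
    nothing, so [P] fixes it. *)
Definition reindexable (X : C) (n : nat) (s : nat -> nat) : Prop :=
  exists P : hom (ftens (fun=> X) n) (ftens (fun=> X) n),
  forall (A : C) (c : nat -> hom A X),
    ftuple (fun i => c (s i)) n = P ∘ ftuple c n.

Definition transp (j k i : nat) : nat :=
  if i == j then k else if i == k then j else i.

Lemma eq_reindexable (X : C) n (s t : nat -> nat) :
  (forall i, i <= n -> s i = t i) -> reindexable X n s -> reindexable X n t.
Proof.
move=> st [P PE]; exists P => A c; rewrite -PE.
by apply: eq_ftuple => i le_in; rewrite st.
Qed.

Lemma reindexable_id (X : C) n : reindexable X n id.
Proof. by exists (idm _) => A c; rewrite comp_idl. Qed.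

Lemma reindexable_comp (X : C) n (s t : nat -> nat) :
  reindexable X n s -> reindexable X n t -> reindexable X n (s \o t).
Proof.
move=> [P PE] [Q QE]; exists (Q ∘ P) => A c.
by rewrite -comp_assoc -PE -(QE _ (fun i => c (s i))).
Qed.

Lemma reindexable_S (X : C) n (s : nat -> nat) :
  s n.+1 = n.+1 -> reindexable X n s -> reindexable X n.+1 s.
Proof.
move=> sn [P PE]; exists (P ⊠ idm X) => A c.
by rewrite !ftuple_pair sn PE tensm_pair comp_idl.
Qed.

Lemma reindexable_adjacent (X : C) n : reindexable X n.+1 (transp n n.+1).
Proof.
have t1 : transp n n.+1 n.+1 = n by rewrite /transp; lia_eq.
have t0 : transp n n.+1 n = n.+1 by rewrite /transp; lia_eq.
case: n t0 t1 => [|n] t0 t1.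
  exists (braid X X) => A c.
  by rewrite !ftuple_pair !ftuple0 t0 t1 braid_pair.
exists (assoc_inv _ _ _ ∘ (idm _ ⊠ braid X X) ∘ assoc _ _ _) => A c.
rewrite !ftuple_pair t0 t1 -!comp_assoc assoc_pair tensm_pair braid_pair.
rewrite comp_idl assoc_inv_pair; congr (pair (pair _ _) _).
by apply: eq_ftuple => i le_in; congr c; rewrite /transp; lia_eq.
Qed.

(** Conjugation: (j n+1) = (n n+1) (j n) (n n+1), where (j n) only concerns the
    first n + 1 factors. *)
Lemma reindexable_transp (X : C) n j : j <= n -> reindexable X n (transp j n).
Proof.
elim: n => [|n IHn]; rewrite leq_eqVlt => /predU1P[-> | ] //.
- by apply: eq_reindexable (reindexable_id X 0) => i; rewrite /transp; lia_eq.
- by apply: eq_reindexable (reindexable_id X _) => i; rewrite /transp; lia_eq.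
rewrite ltnS => le_jn; have adj := reindexable_adjacent X n.
have [->|neq_jn] := eqVneq j n; first exact: adj.
have mid : reindexable X n.+1 (transp j n).
  by apply: reindexable_S (IHn le_jn); rewrite /transp; lia_eq.
apply: eq_reindexable (reindexable_comp adj (reindexable_comp mid adj)) => i _.
by rewrite /= /transp; lia_eq.
Qed.

(** Composing [s] with the transposition of s(n+1) and n+1 yields a map fixing
    n+1, hence stabilising the smaller indices by injectivity. *)
Lemma reindexable_perm (X : C) n (s : nat -> nat) :
  injective s -> (forall i, i <= n -> s i <= n) -> reindexable X n s.
Proof.
elim: n s => [|n IHn] s sinj sle.
  by apply: eq_reindexable (reindexable_id X 0) => i; have := sle i; lia.
pose t := transp (s n.+1) n.+1.
have tK : involutive t by move=> i; rewrite /t /transp; lia_eq.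
have fixn : t (s n.+1) = n.+1 by rewrite /t /transp eqxx.
have ts : reindexable X n.+1 (t \o s).
  apply: reindexable_S => //; apply: IHn.
    exact: inj_comp (inv_inj tK) sinj.
  move=> i le_in; have le_s := sle i (leqW le_in).
  have ne : s i <> s n.+1 by move/sinj => ei; rewrite ei ltnn in le_in.
  by have := sle _ (leqnn n.+1); rewrite /= /t /transp; lia_eq.
have tr : reindexable X n.+1 t := reindexable_transp X (sle _ (leqnn _)).
by apply: eq_reindexable (reindexable_comp tr ts) => i _; apply: tK.
Qed.

Lemma pair_marginals (A U V : C) (f : hom A (U ⊗ V)) :
  copyable f ->
  pair (runit U ∘ (idm U ⊠ del V) ∘ f) (lunit V ∘ (del U ⊠ idm V) ∘ f) = f.
Proof. by move=> cf; rewrite -pair_comp // /pair pair_proj comp_idl. Qed.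

Lemma copyable_flast (X : nat -> C) n : copyable (flast X n).
Proof.
case: n => [|n]; first exact: copyable_id.
apply: copyable_comp (@copyable_lunit C _) _.
exact: copyable_tensm (@copyable_del C _) (@copyable_id C _).
Qed.

End Tuples.

(** * Morphisms into Kolmogorov products *)

Section KolmogorovProducts.
Context {C : cd_category}.

Lemma kp_ext (X : nat -> C) (K : kolmogorov_product X) (A : C)
    (f g : hom A K) :
  (forall n, kp_proj K n ∘ f = kp_proj K n ∘ g) -> f = g.
Proof.
move=> fg; have comm n :
    trunc X n ∘ (kp_proj K n.+1 ∘ g) = kp_proj K n ∘ g.
  by rewrite comp_assoc (cone_comm (kp_limit K)).
rewrite (lift_uniq (kp_limit K) comm fg).
by rewrite -(lift_uniq (kp_limit K) comm (fun=> erefl _)).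
Qed.

Lemma kp_tens_ext (X : nat -> C) (K : kolmogorov_product X) (A Y : C)
    (f g : hom A (K ⊗ Y)) :
  (forall n, (kp_proj K n ⊠ idm Y) ∘ f = (kp_proj K n ⊠ idm Y) ∘ g) -> f = g.
Proof.
move=> fg; have comm n :
    (trunc X n ⊠ idm Y) ∘ ((kp_proj K n.+1 ⊠ idm Y) ∘ g)
    = (kp_proj K n ⊠ idm Y) ∘ g.
  by rewrite comp_assoc -tensm_comp comp_idl (cone_comm (kp_limit K)).
rewrite (lift_uniq (kp_limit_tens K Y) comm fg).
by rewrite -(lift_uniq (kp_limit_tens K Y) comm (fun=> erefl _)).
Qed.

(** Preservation of the limit by tensoring, used once per factor. *)
Lemma kp_tens2_ext (X Z : nat -> C) (K : kolmogorov_product X)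
    (L : kolmogorov_product Z) (A : C) (f g : hom A (K ⊗ L)) :
  (forall n m, (kp_proj K n ⊠ kp_proj L m) ∘ f
               = (kp_proj K n ⊠ kp_proj L m) ∘ g) -> f = g.
Proof.
move=> fg; apply: kp_tens_ext => n.
have braid_inj (B D : C) (u v : hom A (B ⊗ D)) :
    braid B D ∘ u = braid B D ∘ v -> u = v.
  by move=> e; rewrite -[u]comp_idl -[v]comp_idl -braidK -!comp_assoc e.
apply: braid_inj; apply: kp_tens_ext => m.
rewrite !comp_assoc -!braid_nat -![braid _ _ ∘ _ ∘ _ ∘ _]comp_assoc.
rewrite -![braid _ _ ∘ _ ∘ _]comp_assoc.
rewrite !(comp_assoc (idm _ ⊠ kp_proj L m)) -!tensm_comp !comp_idl !comp_idr.
by rewrite fg.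
Qed.

Lemma kp_proj_factor (X : nat -> C) (K : kolmogorov_product X) n N :
  n <= N ->
  exists t : hom (ftens X N) (ftens X n), kp_proj K n = t ∘ kp_proj K N.
Proof.
elim: N => [|N IHN]; rewrite leq_eqVlt => /predU1P[-> | ] //.
- by exists (idm _); rewrite comp_idl.
- by exists (idm _); rewrite comp_idl.
rewrite ltnS => /IHN[t tE]; exists (t ∘ trunc X N).
by rewrite -comp_assoc (cone_comm (kp_limit K)).
Qed.

(** Both projections of the two copies factor through a common finite stage,
    where copyability is assumed. *)
Lemma copyable_kp (X : nat -> C) (K : kolmogorov_product X) (A : C)
    (f : hom A K) :
  (forall n, copyable (kp_proj K n ∘ f)) -> copyable f.
Proof.
move=> cf; apply: kp_tens2_ext => n m.
have [t ->] := kp_proj_factor K (leq_addr m n).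
have [u ->] := kp_proj_factor K (leq_addl n m).
have [_ cK] := kp_proj_det K (n + m).
rewrite -/(pair f f) tensm_pair !tensm_comp -comp_assoc.
rewrite [_ ∘ (copy K ∘ f)]comp_assoc.
rewrite -cK -[copy _ ∘ _ ∘ f]comp_assoc cf -/(pair _ _) tensm_pair.
by rewrite !comp_assoc.
Qed.

Lemma copyable_kp_component (X : nat -> C) (K : kolmogorov_product X) i :
  copyable (kp_component K i).
Proof.
by apply: copyable_comp (copyable_flast X i) _; case: (kp_proj_det K i).
Qed.

Lemma ftuple_kp_component (X : nat -> C) (K : kolmogorov_product X) n :
  ftuple (kp_component K) n = kp_proj K n.
Proof.
elim: n => [|n IHn]; first by rewrite ftuple0 /kp_component comp_idl.
rewrite ftuple_pair IHn -(cone_comm (kp_limit K)) /kp_component.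
by apply: pair_marginals; case: (kp_proj_det K n.+1).
Qed.

End KolmogorovProducts.

(** * Permutation invariance of iterates *)

Section Iterates.
Context {C : quasi_markov_category}.

Lemma kp_permE (X : C) (K : kolmogorov_power X) s n :
  kp_proj K n ∘ kp_perm K s = ftuple (fun i => kp_component K (s i)) n.
Proof. exact: lift_proj. Qed.

Lemma kp_iterE (A X : C) (K : kolmogorov_power X) (f : hom A X) n :
  kp_proj K n ∘ kp_iter K f = ftuple (fun=> f) n.
Proof. exact: lift_proj. Qed.

Lemma kp_iter0 (A X : C) (K : kolmogorov_power X) (f : hom A X) :
  kp_proj K 0 ∘ kp_iter K f = f.
Proof. by rewrite kp_iterE ftuple0. Qed.

Lemma kp_iter_comp (A B X : C) (K : kolmogorov_power X) (f : hom B X)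
    (u : hom A B) :
  copyable u -> kp_iter K f ∘ u = kp_iter K (f ∘ u).
Proof.
move=> cu; apply: kp_ext => n.
by rewrite comp_assoc !kp_iterE ftuple_comp.
Qed.

Lemma copyable_kp_perm (X : C) (K : kolmogorov_power X) s :
  copyable (kp_perm K s).
Proof.
apply: copyable_kp => n; rewrite kp_permE.
by apply: copyable_ftuple => i; apply: copyable_kp_component.
Qed.

(** Beyond the support of s, the projection of the permutation of K is a
    permutation of finitely many factors, which fixes the constant tuple
    f^(n).  The lower projections follow by truncation. *)
Lemma kp_perm_iter (A X : C) (K : kolmogorov_power X) (f : hom A X) s :
  finite_permutation s -> kp_perm K s ∘ kp_iter K f = kp_iter K f.
Proof.
case=> /bij_inj sinj [N sN].
have large n : N <= n ->
    kp_proj K n ∘ (kp_perm K s ∘ kp_iter K f) = kp_proj K n ∘ kp_iter K f.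
  move=> leNn; have sle i : i <= n -> s i <= n.
    move=> le_in; rewrite leqNgt; apply/negP => lt_ns.
    have /sinj si : s (s i) = s i by apply: sN; lia.
    by lia.
  have [P PE] := reindexable_perm X sinj sle.
  rewrite comp_assoc kp_permE PE ftuple_kp_component -comp_assoc kp_iterE.
  by rewrite -PE.
apply: kp_ext => n.
have [t ->] := kp_proj_factor K (leq_addr N n).
by rewrite -!comp_assoc large // leq_addl.
Qed.

End Iterates.

(** * Empirical sampling and its splitting *)

Section EmpiricalSampling.
Context {C : quasi_markov_category} {X : C} {K : kolmogorov_power X}.
Context {es : hom K X}.
Context (es_sampling : empirical_sampling es).
Let e := kp_iter K es.

(** Empirical adequacy with trivial second factor. *)
Lemma es_absorb (A : C) (f : hom A K) :
  (forall s, finite_permutation s -> kp_perm K s ∘ f = f) -> e ∘ f = f.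
Proof.
have runit_inv_nat (B D : C) (u : hom B D) :
    (u ⊠ idm munit) ∘ runit_inv B = runit_inv D ∘ u.
  rewrite -[LHS]comp_idl -runitK -!comp_assoc (comp_assoc (runit D)) runit_nat.
  by rewrite -(comp_assoc u) runit_invK comp_idr.
case: es_sampling => _ absorb sf.
have exf : exchangeable (runit_inv K ∘ f).
  by move=> s ps; rewrite comp_assoc runit_inv_nat -comp_assoc sf.
have := absorb _ _ _ exf; rewrite comp_assoc runit_inv_nat => ef.
rewrite -[LHS]comp_idl -[RHS]comp_idl -(runit_invK K) -!(comp_assoc (runit K)).
by congr (_ ∘ _); rewrite comp_assoc.
Qed.

Lemma es_absorb_iter (A : C) (f : hom A X) :
  e ∘ kp_iter K f = kp_iter K f.
Proof. by apply: es_absorb => s; apply: kp_perm_iter. Qed.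

Lemma es_iter (A : C) (f : hom A X) : es ∘ kp_iter K f = f.
Proof.
by rewrite -{1}(kp_iter0 K es) -comp_assoc es_absorb_iter kp_iter0.
Qed.

Lemma es_idempotent : idempotent e.
Proof. exact: es_absorb_iter. Qed.

(** On finite projections, both copies of es^(N) together draw one finite batch
    of samples from a single empirical measure; by absorption the batch has the
    law of independent draws from f, and such a law splits between the two
    copies. *)
Lemma es_resample (A : C) (f : hom A X) :
  (e ⊠ e) ∘ copy K ∘ kp_iter K f = pair (kp_iter K f) (kp_iter K f).
Proof.
apply: kp_tens2_ext => n m; have [P PE] := ftuple_const_cat X n m.
rewrite tensm_pair !kp_iterE PE -(kp_iterE K) !comp_assoc -tensm_comp.
rewrite !kp_iterE -/(pair _ _) PE -(kp_iterE K).
by rewrite -!comp_assoc es_absorb_iter.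
Qed.

Lemma es_invariant s : finite_permutation s -> e ∘ kp_perm K s = e.
Proof.
case: es_sampling => inv _ ps.
by rewrite /e kp_iter_comp ?inv //; apply: copyable_kp_perm.
Qed.

(** The morphism (id ⊗ e) copy e is exchangeable in its first factor: e absorbs
    the permutation that the copyable X^σ creates in the second copy.
    Adequacy then allows resampling the first factor as well, and the result
    (e ⊗ e) copy e is symmetric. *)
Lemma es_balanced : balanced e.
Proof.
have half : (e ⊠ e) ∘ copy K ∘ e = (idm K ⊠ e) ∘ copy K ∘ e.
  case: es_sampling => _ /(_ _ _ ((idm K ⊠ e) ∘ copy K ∘ e)) <-.
    by rewrite !comp_assoc -tensm_comp comp_idl comp_idr.
  move=> s ps.
  transitivity ((idm K ⊠ e) ∘ ((kp_perm K s ⊠ kp_perm K s) ∘ copy K) ∘ e).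
    by rewrite !comp_assoc -!tensm_comp !comp_idl comp_idr es_invariant.
  by rewrite -copyable_kp_perm -!comp_assoc kp_perm_iter.
by rewrite /balanced [RHS]braid_copy -half -braid_copy.
Qed.

(** Positivity applies to r i = id and expresses copy on [E] through copy on
    [K], namely copy = (r ⊗ r) copy i.  Resampling an iterate then splits the
    two copies.  The case of the iterate e itself comes first, since r = r e:
    it yields copyability of r, on which the case of a general iterate
    relies. *)
Lemma es_split_copyable (E : C) (r : hom K E) (i : hom E K) :
  positive C -> e = i ∘ r -> r ∘ i = idm E ->
  copyable r /\ forall (A : C) (f : hom A X), copyable (r ∘ kp_iter K f).
Proof.
move=> Cpos eir ri; have re : r ∘ e = r by rewrite eir comp_assoc ri comp_idl.
have copyE : copy E = (r ⊠ r) ∘ copy K ∘ i.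
  have := @positive_pair C E K E i r Cpos.
  rewrite ri => /(_ (@copyable_id C E)) ir.
  rewrite -{1}[r]comp_idl -[X in _ ⊠ X]comp_idr tensm_comp.
  rewrite -!comp_assoc (comp_assoc _ (copy K)) ir tensm_pair ri comp_idl.
  exact/esym/pair_id.
have resample (A : C) (f : hom A X) :
    (r ⊠ r) ∘ copy K ∘ kp_iter K f = pair (r ∘ kp_iter K f) (r ∘ kp_iter K f).
  by rewrite -tensm_pair -es_resample -{1 2}re tensm_comp !comp_assoc.
have copy_r : copyable r.
  by rewrite /copyable copyE -!comp_assoc -eir comp_assoc resample -/e re.
split=> // A f.
by rewrite /copyable comp_assoc [copy E ∘ r]copy_r resample.
Qed.

(** The map es factors as (es i) r, and (-)^# may be moved across the copyable
    morphisms r and r f^(N), though not across f^(N) itself. *)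
Lemma sharp_es_iter (PX : distribution_object X) (A : C) (f : hom A X) :
  positive C -> splits e ->
  sharp PX es ∘ kp_iter K f = sharp PX f.
Proof.
move=> Cpos [E [r [i [eir ri]]]].
have [cr crf] := es_split_copyable Cpos eir ri.
rewrite -{1}(es_iter es) -/e eir comp_assoc sharp_nat // -comp_assoc.
rewrite -sharp_nat //.
by rewrite -comp_assoc (comp_assoc i) -eir es_absorb_iter es_iter.
Qed.

End EmpiricalSampling.

(** * Almost sure constancy of empirical measures *)

Theorem corollary4p11 (C : quasi_markov_category)
  (Cpos : positive C) (Ccont : sigma_continuous C)
  (kprod : forall X : nat -> C, kolmogorov_product X)
  (Csplit : forall (X : C) (e : hom X X),
     idempotent e -> balanced e -> splits e)
  (es : forall X : C, hom (kprod (fun _ => X)) X)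
  (es_sampling : forall X : C, empirical_sampling (es X))
  (X : C) (PX : distribution_object X)
  (p : hom munit X) (m : hom PX X) :
  as_equal (kp_iter (kprod (fun _ => X)) p)
    (m ∘ sharp PX (es X))
    (m ∘ sharp PX p ∘ del (kprod (fun _ => X))).
Proof.
set K := kprod _; set q := kp_iter K p.
have esq : sharp PX (es X) ∘ q = sharp PX p.
  apply: sharp_es_iter Cpos _; first exact: es_sampling.
  by apply: Csplit; [exact: es_idempotent | exact: es_balanced].
have joint : (sharp PX (es X) ⊠ idm K) ∘ copy K ∘ q = pair (sharp PX p) q.
  by rewrite positive_pair // esq //; apply: sharp_copyable.
rewrite /as_equal pair_const -{1}[idm K]comp_idl tensm_comp.
by rewrite -!comp_assoc (comp_assoc _ (copy K)) joint tensm_pair comp_idl.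
Qed.
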